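(* A finite cyclic subgroup $G$ of $\mathrm{PGL}_3(\mathbb{C})$ of order $n\ge 3$ is definable over $\mathbb{R}$ if there exists $A\in\mathrm{GL}_3(\mathbb{C})$ such that $\pi(A)$ generates $G$ in $\mathrm{PGL}_3(\mathbb{C})$ and the characteristic polynomial $f_A(t)$ of $A$ lies in $\mathbb{R}[t]$. The converse is not necessarily true.
   Context: $\pi:\mathrm{GL}_3(\mathbb{C})\to\mathrm{PGL}_3(\mathbb{C})$ is the natural projection. A finite subgroup $G\subset\mathrm{PGL}_3(\mathbb{C})$ is definable over $\mathbb{R}$ if it is $\mathrm{PGL}_3(\mathbb{C})$-conjugate to some subgroup of $\mathrm{PGL}_3(\mathbb{R})\subset\mathrm{PGL}_3(\mathbb{C})$.
   Formalization: The literal converse (G definable over R implies some such A exists) is true: conjugate a real lift of a generator. What is proved instead of its failure: for some definable G of order 3, not every A with π(A) generating G has f_A in R[t]. *)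

(* Defs.v *)
From HB Require Import structures.
From mathcomp Require Import all_boot all_order all_algebra.
From mathcomp Require Import boolp classical_sets functions cardinality reals.
From mathcomp Require Import complex.

Set Implicit Arguments.
Unset Strict Implicit.
Unset Printing Implicit Defensive.

Import Order.TTheory GRing.Theory Num.Theory.

Local Open Scope classical_set_scope.
Local Open Scope quotient_scope.
Local Open Scope ring_scope.

(* The library's {'GL_n[F]} needs a finite F, hence the version below. *)
Section GeneralLinearGroup.
Variables (n : nat) (F : fieldType).

Record GL := MkGL { GLmx :> 'M[F]_n; GLmx_unit : GLmx \in unitmx }.

HB.instance Definition _ := [isSub for GLmx].
HB.instance Definition _ := [Choice of GL by <:].

Definition GLone : GL := MkGL (unitmx1 F n).

Fact GLmul_unit (A B : GL) : A *m B \in unitmx.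
Proof. by rewrite unitmx_mul !GLmx_unit. Qed.
Definition GLmul (A B : GL) : GL := MkGL (GLmul_unit A B).

Fact GLinv_unit (A : GL) : invmx A \in unitmx.
Proof. by rewrite unitmx_inv GLmx_unit. Qed.
Definition GLinv (A : GL) : GL := MkGL (GLinv_unit A).

Fact GLmulA : associative GLmul.
Proof. by move=> A B C; apply/val_inj/mulmxA. Qed.
Fact GLmul1 : left_id GLone GLmul.
Proof. by move=> A; apply/val_inj/mul1mx. Qed.
Fact GLmulr1 : right_id GLone GLmul.
Proof. by move=> A; apply/val_inj/mulmx1. Qed.
Fact GLmulV : left_inverse GLone GLinv GLmul.
Proof. by move=> A; apply/val_inj/mulVmx/GLmx_unit. Qed.
Fact GLmulrV : right_inverse GLone GLinv GLmul.
Proof. by move=> A; apply/val_inj/mulmxV/GLmx_unit. Qed.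

HB.instance Definition _ :=
  isGroup.Build GL GLmulA GLmul1 GLmulr1 GLmulV GLmulrV.

End GeneralLinearGroup.

Section ProjectiveLinearGroup.
Variables (n : nat) (F : fieldType).
Implicit Types A B : GL n F.

(* PGL_n is the quotient of GL_n by its subgroup of nonzero scalar matrices. *)
Definition proportional A B : bool :=
  `[< exists2 c : F, c != 0 & GLmx A = c *: GLmx B >].

Fact proportional_refl : reflexive proportional.
Proof. by move=> A; apply/asboolP; exists 1; rewrite ?oner_eq0 ?scale1r. Qed.

Fact proportional_sym : symmetric proportional.
Proof.
suff sub A B : proportional A B -> proportional B A.
  by move=> A B; apply/idP/idP => /sub.
move=> /asboolP[c c0 AB]; apply/asboolP; exists c^-1; first by rewrite invr_eq0.
by rewrite AB scalerA mulVf ?scale1r.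
Qed.

Fact proportional_trans : transitive proportional.
Proof.
move=> B A C /asboolP[c c0 AB] /asboolP[d d0 BC]; apply/asboolP.
by exists (c * d); rewrite ?mulf_neq0 // AB BC scalerA.
Qed.

Canonical proportional_equiv :=
  EquivRel proportional proportional_refl proportional_sym proportional_trans.

Definition PGL := {eq_quot proportional}.
HB.instance Definition _ := Choice.on PGL.
HB.instance Definition _ := EqQuotient.on PGL.

Definition GLproj (A : GL n F) : PGL := \pi_PGL A.

Lemma GLprojP A B :
  GLproj A = GLproj B <-> exists2 c : F, c != 0 & GLmx A = c *: GLmx B.
Proof. by split=> [/eqmodP/asboolP|] // AB; apply/eqmodP/asboolP. Qed.

Definition PGLone : PGL := GLproj 1%g.
Definition PGLmul (x y : PGL) : PGL := GLproj (repr x * repr y)%g.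
Definition PGLinv (x : PGL) : PGL := GLproj (repr x)^-1%g.

Lemma PGL_ind (P : PGL -> Prop) : (forall A, P (GLproj A)) -> forall x, P x.
Proof. by move=> PA x; rewrite -[x]reprK; apply: PA. Qed.

Fact repr_GLproj A : exists2 c : F, c != 0 & GLmx (repr (GLproj A)) = c *: GLmx A.
Proof. by apply/GLprojP; rewrite /GLproj reprK. Qed.

Fact GLproj_mul A B : PGLmul (GLproj A) (GLproj B) = GLproj (A * B)%g.
Proof.
have [c c0 cA] := repr_GLproj A; have [d d0 dB] := repr_GLproj B.
apply/GLprojP; exists (c * d); first by rewrite mulf_neq0.
by rewrite /= cA dB -scalemxAl -scalemxAr scalerA.
Qed.

Fact GLproj_inv A : PGLinv (GLproj A) = GLproj A^-1%g.
Proof.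
have [c c0 cA] := repr_GLproj A.
apply/GLprojP; exists c^-1; first by rewrite invr_eq0.
by rewrite /= cA invmxZ // -?cA ?GLmx_unit.
Qed.

Fact PGLmulA : associative PGLmul.
Proof. by do 3!elim/PGL_ind=> ?; rewrite !GLproj_mul mulgA. Qed.
Fact PGLmul1 : left_id PGLone PGLmul.
Proof. by elim/PGL_ind=> A; rewrite GLproj_mul mul1g. Qed.
Fact PGLmulr1 : right_id PGLone PGLmul.
Proof. by elim/PGL_ind=> A; rewrite GLproj_mul mulg1. Qed.
Fact PGLmulV : left_inverse PGLone PGLinv PGLmul.
Proof. by elim/PGL_ind=> A; rewrite GLproj_inv GLproj_mul mulVg. Qed.
Fact PGLmulrV : right_inverse PGLone PGLinv PGLmul.
Proof. by elim/PGL_ind=> A; rewrite GLproj_inv GLproj_mul mulgV. Qed.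

HB.instance Definition _ :=
  isGroup.Build PGL PGLmulA PGLmul1 PGLmulr1 PGLmulV PGLmulrV.

Fact GLprojM : {morph GLproj : A B / (A * B)%g}.
Proof. by move=> A B; rewrite -GLproj_mul. Qed.
HB.instance Definition _ :=
  isUMagmaMorphism.Build (GL n F) PGL GLproj (erefl, GLprojM).

End ProjectiveLinearGroup.

Section BaseChange.
Variables (n : nat) (F K : fieldType) (f : {rmorphism F -> K}).

Fact GLmap_unit (A : GL n F) : map_mx f A \in unitmx.
Proof. by rewrite map_unitmx GLmx_unit. Qed.
Definition GLmap (A : GL n F) : GL n K := MkGL (GLmap_unit A).

Definition PGLmap (x : PGL n F) : PGL n K := GLproj (GLmap (repr x)).

Lemma PGLmap_proj (A : GL n F) : PGLmap (GLproj A) = GLproj (GLmap A).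
Proof.
have [c c0 cA] := repr_GLproj A.
by apply/GLprojP; exists (f c); rewrite ?fmorph_eq0 //= cA map_mxZ.
Qed.

Fact PGLmapM : {morph PGLmap : x y / (x * y)%g}.
Proof.
elim/PGL_ind=> A; elim/PGL_ind=> B; rewrite -GLprojM !PGLmap_proj -GLprojM.
by congr GLproj; apply: val_inj; rewrite /= map_mxM.
Qed.

Fact PGLmap1 : PGLmap 1%g = 1%g.
Proof.
by rewrite PGLmap_proj; congr GLproj; apply: val_inj; rewrite /= map_mx1.
Qed.

HB.instance Definition _ :=
  isUMagmaMorphism.Build (PGL n F) (PGL n K) PGLmap (PGLmap1, PGLmapM).

Lemma PGLmap_inj : injective PGLmap.
Proof.
elim/PGL_ind=> A; elim/PGL_ind=> B; rewrite !PGLmap_proj => /GLprojP[c c0 /= AB].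
apply/GLprojP; have [B0|/matrix0Pn[i [j Bij]]] := eqVneq (GLmx B) 0.
  move/eqP: AB; rewrite B0 map_mx0 scaler0 map_mx_eq0 => /eqP ->.
  by exists 1; rewrite ?oner_eq0 ?scaler0.
have cE : c = f (A i j / B i j).
  have /matrixP/(_ i j) := AB; rewrite !mxE fmorph_div => ->.
  by rewrite mulfK ?fmorph_eq0.
exists (A i j / B i j); first by rewrite -(fmorph_eq0 f) -cE.
apply: (@map_mx_inj _ _ f); by rewrite AB cE map_mxZ.
Qed.

End BaseChange.

Section Subgroups.
Variable T : groupType.
Implicit Types (H : set T) (x : T).

Definition is_subgroup H : Prop := group_closed [in H].

Definition generates x H : Prop := smallest is_subgroup [set x] = H.

Definition is_cyclic H : Prop := exists x, generates x H.

End Subgroups.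

(* PGL_3(R) sits inside PGL_3(C) through the injective morphism
   PGLmap (real_complex R), see PGLmapM and PGLmap_inj. *)
Definition PGL3_definable_over_R (R : realType) (G : set (PGL 3 R[i])) : Prop :=
  exists (H : set (PGL 3 R)) (g : PGL 3 R[i]),
    is_subgroup H /\
    [set (x ^ g)%g | x in G] = [set PGLmap (real_complex R) y | y in H].

Definition has_real_coefs (R : realType) (p : {poly R[i]}) : Prop :=
  exists q : {poly R}, p = map_poly (real_complex R) q.

(* Main.v *)
Require Import Defs.
From mathcomp Require Import all_boot all_order all_algebra.
From mathcomp Require Import boolp classical_sets functions cardinality reals.
From mathcomp Require Import complex.
From mathcomp Require Import perm separable.

(** Suppose [GLproj A] generates the finite group [G]. Then some power of [A]
    is a nonzero scalar [c], so the minimal polynomial of [A] divides the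
    separable polynomial 'X^k - c and [A] is diagonalizable
    ([diagonalizable_root_scalar]). If moreover the characteristic polynomial
    is real, conjugation permutes the eigenvalues of [A] with their
    multiplicities, and one can choose an involution of the indices that
    realizes it: d (s i) = (d i)^*. With S the permutation matrix of s and D
    the diagonal form, this says that D^* = S D S with S real and S S = 1.
    The matrix T = a + a^* S is invertible when a = 1 + i and satisfies
    T^* = S T, hence T^-1 D T is its own conjugate: [A] is similar to a real
    matrix B ([real_form_diagonalizable]). The matrix of this similarity
    conjugates the generator of [G] to the class of B, and with the generator
    the whole of [G] moves into PGL_3(R) ([definable_of_generator]).

    For the failure of the converse, a generator has many lifts to GL_3, which
    differ by scalars, and most of them do not have a real characteristic
    polynomial. For an invertible real B of size 3 the determinant of i B is
    -i det B, a nonzero purely imaginary number, so that the constant coefficient of the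
    characteristic polynomial of i B is not real; yet i B and B generate the
    same group. The group used is the one of order 3 generated by a cyclic
    permutation matrix ([PGL3_order3]). *)

Local Open Scope classical_set_scope.
Local Open Scope ring_scope.

Set Implicit Arguments.
Unset Strict Implicit.
Unset Printing Implicit Defensive.

Import GRing.Theory Num.Theory.

(** * Diagonalizability of matrices with a scalar power *)

Section Diagonalization.

(** The relation P A = B P persists between the characteristic matrices, and
    the determinant of P cancels in the domain of polynomials. *)
Lemma char_poly_intertwine (F : fieldType) (n : nat) (P A B : 'M[F]_n) :
  P \in unitmx -> P *m A = B *m P -> char_poly A = char_poly B.
Proof.
move=> Pu PA; pose Q := map_mx polyC P.
have Q0 : \det Q != 0 by rewrite det_map_mx polyC_eq0 -unitfE -unitmxE.
have QA : Q *m char_poly_mx A = char_poly_mx B *m Q.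
  by rewrite mulmxBr mulmxBl -!map_mxM /= PA scalar_mxC.
by apply: (mulfI Q0); rewrite -det_mulmx QA det_mulmx mulrC.
Qed.

(** The derivative is a nonzero multiple of a power of 'X, and 0 is not a root
    of 'X^n - c. *)
Lemma separable_XnsubC (F : numFieldType) (n : nat) (c : F) :
  (0 < n)%N -> c != 0 -> separable_poly ('X^n - c%:P).
Proof.
case: n => // n _ c0; rewrite separable_poly.unlock derivB derivC subr0.
rewrite derivXn /= -scaler_nat coprimepZr ?pnatr_eq0 //; apply: coprimep_expr.
rewrite -['X]subr0 -polyC0 coprimep_XsubC rootE !hornerE.
by rewrite oppr0 expr0n sub0r oppr_eq0.
Qed.

(** The minimal polynomial of [A] divides 'X^k - c, which splits into distinct
    linear factors. *)
Lemma diagonalizable_root_scalar (F : numClosedFieldType) (n k : nat)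
    (A : 'M[F]_n.+1) (c : F) :
    (0 < k)%N -> c != 0 -> A ^+ k = c%:M ->
  exists (P : 'M[F]_n.+1) (d : 'rV[F]_n.+1),
    P \in unitmx /\ P *m A = diag_mx d *m P.
Proof.
move=> k0 c0 Ak.
have [rs Ers] := closed_field_poly_normal ('X^k - c%:P).
have mon : lead_coef ('X^k - c%:P) = 1.
  by apply/eqP; exact: monicXnsubC.
rewrite mon scale1r in Ers.
have : mxred.diagonalizable A.
  apply/mxred.diagonalizableP; exists rs.
    by rewrite -separable_prod_XsubC -Ers separable_XnsubC.
  rewrite -Ers; apply: mxminpoly_min.
  by rewrite rmorphB rmorphXn /= horner_mx_X horner_mx_C Ak subrr.
move=> [P Pu /(mxred.similar_diagLR Pu)[d ->]]; exists P, d; split=> //.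
by rewrite mxred.conjVmx // !mulmxA mulmxV // mul1mx.
Qed.

End Diagonalization.

(** * Real forms of diagonalizable matrices *)

Section Descent.

(** Up to the scalar a^2 - b^2, the inverse is a - b S. *)
Lemma unitmx_add_involution (F : fieldType) (n : nat) (S : 'M[F]_n) (a b : F) :
  S *m S = 1%:M -> a ^+ 2 != b ^+ 2 -> a%:M + b *: S \in unitmx.
Proof.
move=> SS; rewrite -subr_eq0 => c0; set c := _ - _ in c0.
suff /mulmx1_unit[] :
  (a%:M + b *: S) *m (c^-1 *: (a%:M - b *: S)) = 1%:M by [].
rewrite -scalemxAr mulmxDl !mulmxBr -!scalemxAl -!scalemxAr SS.
rewrite !mul_scalar_mx mul_mx_scalar !scalerA [b * a]mulrC.
rewrite addrA subrK scale_scalar_mx scalemx1 -raddfB scale_scalar_mx.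
by rewrite -!expr2 mulVf.
Qed.

(** The fibres of [d] over [v] and [f v] have the same cardinality. Matching
    them by the rank of their elements in the enumeration of the indices gives
    an involution, because the rank is preserved. *)
Lemma involution_of_perm_eq (T : eqType) (f : T -> T) (n : nat) (d : 'I_n -> T) :
    involutive f -> perm_eq (codom d) (map f (codom d)) ->
  exists2 s : 'S_n, (s * s = 1)%g & forall i, d (s i) = f (d i).
Proof.
move=> fK pd; pose E v := enum [pred j | d j == v].
have memE v j : (j \in E v) = (d j == v) by rewrite mem_enum.
have sizeE v : size (E v) = count_mem v (codom d).
  rewrite count_map /E /enum_mem size_filter -enumT count_filter.
  by apply: eq_count => j; rewrite /= andbT.
have sizeEf v : size (E (f v)) = size (E v).
  rewrite !sizeE (seq.permP pd) count_map; apply: eq_count => x /=.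
  by rewrite (inj_eq (inv_inj fK)).
pose h i := nth i (E (f (d i))) (index i (E (d i))).
have idx i : (index i (E (d i)) < size (E (f (d i))))%N.
  by rewrite sizeEf index_mem memE.
have dh i : d (h i) = f (d i) by apply/eqP; rewrite -memE mem_nth.
have hK : involutive h.
  move=> i; rewrite {1}/h dh fK {2}/h index_uniq ?enum_uniq //.
  by rewrite (set_nth_default i) ?nth_index ?memE // index_mem memE.
exists (perm (inv_inj hK)) => [|i]; last by rewrite permE.
by apply/permP => i; rewrite permM !permE hK.
Qed.

Variable R : rcfType.

Lemma conjmx_real (m n : nat) (A : 'M[R[i]]_(m, n)) :
  map_mx conjc A = A -> exists B, A = map_mx (real_complex R) B.
Proof.
move=> Ac; exists (map_mx (@complex.Re R) A); apply/matrixP => i j.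
have := congr1 (fun M : 'M_(m, n) => M i j) Ac; rewrite !mxE.
case: (A i j) => a b /= [] /eqP; rewrite eq_sym -subr_eq0 opprK -mulr2n.
by rewrite mulrn_eq0 /= => /eqP ->.
Qed.

(** Hilbert 90 made explicit: S is a cocycle that compares the diagonal form
    with its conjugate, and T = a + a^* S trivializes it. *)
Lemma real_form_diagonalizable (n : nat) (A P : 'M[R[i]]_n) (d : 'rV[R[i]]_n)
    (q : {poly R}) :
    P \in unitmx -> P *m A = diag_mx d *m P ->
    char_poly A = map_poly (real_complex R) q ->
  exists (Q : 'M[R[i]]_n) (B : 'M[R]_n),
    Q \in unitmx /\ Q *m A = map_mx (real_complex R) B *m Q.
Proof.
move=> Pu PA qA.
have chA : char_poly A = \prod_(x <- codom (d 0)) ('X - x%:P).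
  rewrite (char_poly_intertwine Pu PA) char_poly_trig ?diag_mx_is_trig //.
  rewrite big_map enumT.
  by apply: eq_bigr => i _; rewrite mxE eqxx mulr1n.
have : perm_eq (codom (d 0)) (map conjc (codom (d 0))).
  apply: prod_XsubC_eq; rewrite -chA big_map.
  rewrite -(map_prod_XsubC conjc) -chA qA -map_poly_comp.
  by apply: eq_map_poly => x /=; rewrite oppr0.
case/(involution_of_perm_eq (@conjcK R)) => s ss ds.
set S : 'M[R[i]]_n := perm_mx s.
have SS : S *m S = 1%:M by rewrite -perm_mxM ss perm_mx1.
(* Any a whose square is not real would do. *)
pose a := Complex 1 1 : R[i].
have aa : a ^+ 2 != conjc a ^+ 2.
  rewrite -subr_eq0 subr_sqr mulf_neq0 // eq_complex /=.
    by rewrite opprK -mulr2n pnatr_eq0 andbF.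
  by rewrite -mulr2n pnatr_eq0.
pose T : 'M[R[i]]_n := a%:M + conjc a *: S.
have Tu : T \in unitmx by exact: unitmx_add_involution.
have conjT : map_mx conjc T = S *m T.
  rewrite /T map_mxD map_mxZ map_scalar_mx map_perm_mx [X in X *: _]conjcK.
  by rewrite mulmxDr -scalemxAr SS mul_mx_scalar scalemx1 addrC.
have conjD : map_mx conjc (diag_mx d) = S *m diag_mx d *m S.
  have sV : (s^-1 = s)%g by apply: (mulgI s); rewrite mulgV ss.
  rewrite {2}/S -sV -col_permE -row_permE; apply/matrixP => i j; rewrite !mxE.
  by rewrite (inj_eq perm_inj) rmorphMn /= ds.
have [B BE] : exists B, invmx T *m diag_mx d *m T = map_mx (real_complex R) B.
  apply: conjmx_real; rewrite !map_mxM map_invmx conjT conjD.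
  have -> : invmx (S *m T) = invmx T *m S.
    have STu : S *m T \in unitmx by rewrite unitmx_mul Tu (mulmx1_unit SS).1.
    apply: (can_inj (mulmxK STu)).
    by rewrite mulVmx // mulmxA -(mulmxA _ S S) SS mulmx1 mulVmx.
  by rewrite !mulmxA -(mulmxA _ S S) SS mulmx1 -!mulmxA (mulmxA S S) SS mul1mx.
exists (invmx T *m P), B; split; first by rewrite unitmx_mul unitmx_inv Tu.
by rewrite -BE -(mulmxA _ P) PA !mulmxA mulmxK.
Qed.

End Descent.

(** * Cyclic subgroups of a group *)

Section CyclicSubgroups.
Variable T : groupType.
Implicit Types (x y : T) (G H : set T).

Lemma is_subgroupP H :
  is_subgroup H <-> H 1%g /\ forall x y, H x -> H y -> H (x * y^-1)%g.
Proof.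
have memH x : (x \in [in H]) <-> H x by rewrite unfold_in inE.
split=> -[/memH H1 HB]; split=> // x y.
  by move=> Hx Hy; apply/memH/HB; apply/memH.
by move=> /memH Hx /memH Hy; apply/memH/HB.
Qed.

Lemma generates_subgroup x G : generates x G -> is_subgroup G.
Proof.
move=> <-; apply/is_subgroupP; split=> [H [/is_subgroupP[]]//|y z Gy Gz H HH].
have [/is_subgroupP[_ HB] _] := HH.
by apply: HB; [apply: Gy|apply: Gz].
Qed.

Lemma generates_mem x G : generates x G -> G x.
Proof. by move=> <- H [_]; apply. Qed.

Lemma generates_sub x G H :
  generates x G -> is_subgroup H -> H x -> G `<=` H.
Proof. by move=> <- Hs Hx; apply: smallest_sub => // y ->. Qed.

Lemma subgroupX G x k : is_subgroup G -> G x -> G (x ^+ k)%g.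
Proof.
move=> /is_subgroupP[G1 GB] Gx; elim: k => [|k IHk]; first by rewrite expg0.
rewrite expgSr -[x in (_ * x)%g]invgK; apply: (GB) => //.
by rewrite -[(x^-1)%g]mul1g; apply: GB.
Qed.

(** Two equal powers x^i = x^j with i < j give the relation x^(j-i) = 1. *)
Lemma inj_powers x (A : set nat) :
    (forall i j, A j -> (i < j)%N -> x ^+ (j - i) <> 1)%g ->
  {in A &, injective (fun k => x ^+ k)%g}.
Proof.
move=> x1 i j; rewrite !inE => Ai Aj xij.
by case: (ltngtP i j) => // ij; [case: (x1 i j)|case: (x1 j i)];
  rewrite // expgnFr 1?ltnW // xij mulgV.
Qed.

Lemma finite_subgroup_torsion G x :
  is_subgroup G -> finite_set G -> G x ->
  exists2 k, (0 < k)%N & (x ^+ k = 1)%g.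
Proof.
move=> Gs Gf Gx; apply: contrapT => nok.
have inj : {in [set: nat] &, injective (fun k => x ^+ k)%g}.
  by apply: inj_powers => i j _ ij xij; apply: nok; exists (j - i)%N;
    rewrite ?subn_gt0.
apply: infinite_nat; rewrite -(eq_finite_set (inj_card_eq inj)).
by apply: sub_finite_set Gf => _ [k _ <-]; apply: subgroupX.
Qed.

(** Exponents may be reduced modulo [n], and then x^(n-j) is the inverse of
    x^j. *)
Lemma generates_powers x n :
  (0 < n)%N -> (x ^+ n = 1)%g -> generates x [set (x ^+ k)%g | k in `I_n].
Proof.
move=> n0 xn; have xmod k : (x ^+ (k %% n) = x ^+ k)%g.
  by rewrite {2}(divn_eq k n) expgnDr mulnC expgnA xn expg1n mul1g.
apply/seteqP; split=> [|_ [k _ <-] H [Hs Hx]]; last first.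
  by apply: subgroupX => //; apply: Hx.
apply: smallest_sub => [|_ ->]; last first.
  by exists (1 %% n)%N; rewrite /= ?ltn_mod // xmod.
apply/is_subgroupP; split; first by exists 0%N.
move=> _ _ [i _ <-] [j /= jn <-]; exists ((i + (n - j)) %% n)%N => /=.
  by rewrite ltn_mod.
by rewrite xmod expgnDr expgnFr ?(ltnW jn) // xn mul1g.
Qed.

Lemma card_powers x n :
    (forall k, (0 < k < n)%N -> x ^+ k <> 1)%g ->
  ([set (x ^+ k)%g | k in `I_n] #= `I_n)%card.
Proof.
move=> xk; apply: inj_card_eq; apply: inj_powers => i j jn ij; apply: xk.
by rewrite subn_gt0 ij (leq_ltn_trans (leq_subr _ _)).
Qed.

End CyclicSubgroups.

(** * Cyclic subgroups of the projective linear group *)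

Lemma GLmxX (n : nat) (F : fieldType) (A : GL n.+1 F) k :
  GLmx (A ^+ k)%g = GLmx A ^+ k.
Proof. by elim: k => [|k IHk] //; rewrite expgS exprS -IHk. Qed.

(** The elements that [g] conjugates into the image of PGL_3(R) form a
    subgroup, so it contains [G] as soon as it contains a generator. *)
Lemma definable_of_generator (R : realType) (G : set (PGL 3 R[i]))
    (x g : PGL 3 R[i]) (y : PGL 3 R) :
    generates x G -> (x ^ g)%g = PGLmap (real_complex R) y ->
  PGL3_definable_over_R G.
Proof.
move=> xG xy; have [G1 GB] := (is_subgroupP G).1 (generates_subgroup xG).
have GK : G `<=` [set z | exists t, (z ^ g)%g = PGLmap (real_complex R) t].
  apply: (generates_sub xG); last by exists y.
  apply/is_subgroupP; split; first by exists 1%g; rewrite conj1g gmulf1.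
  move=> u v [t ut] [w vw]; exists (t * w^-1)%g.
  by rewrite conjMg conjVg ut vw gmulfM gmulfV.
exists [set t | G (PGLmap (real_complex R) t ^ g^-1)%g], g; split.
  apply/is_subgroupP; split; first by rewrite /= gmulf1 conj1g.
  by move=> u v /= Gu Gv; rewrite gmulfM gmulfV conjMg conjVg; apply: GB.
apply/seteqP; split=> [_ [z Gz <-]|_ [t Gt <-]].
  by have [t zt] := GK _ Gz; exists t; rewrite //= -zt conjgK.
by exists (PGLmap (real_complex R) t ^ g^-1)%g; rewrite //= conjgKV.
Qed.

(** The matrix of a 3-cycle is not scalar, and its cube is the identity. *)
Lemma PGL3_order3 (F : fieldType) :
  exists B : GL 3 F, (GLproj B ^+ 3 = 1)%g /\ GLproj B <> 1%g.
Proof.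
pose s : 'S_3 := perm (@ordS_inj 3).
have Bu : perm_mx s \in @unitmx F 3 by exact: unitmx_perm.
exists (MkGL Bu); split.
  rewrite -gmulfXn; congr GLproj; apply: val_inj; rewrite /= -!perm_mxM.
  rewrite -perm_mx1; congr perm_mx; apply/permP => i.
  by rewrite !permM !permE; apply: val_inj; case: i => [[|[|[|]]]].
move=> /GLprojP[c _] /= /matrixP/(_ ord0 (inord 1)); rewrite !mxE permE.
by rewrite -!val_eqE /= inordK //= mulr0; apply/eqP; rewrite oner_eq0.
Qed.

Theorem corollary2p3 (R : realType) :
  (forall (n : nat) (G : set (PGL 3 R[i])),
     (3 <= n)%N -> is_subgroup G -> is_cyclic G -> (G #= `I_n)%card ->
     (exists A : GL 3 R[i],
        generates (GLproj A) G /\ has_real_coefs (char_poly A)) ->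
     PGL3_definable_over_R G)
  /\
  ~ (forall (n : nat) (G : set (PGL 3 R[i])),
       (3 <= n)%N -> is_subgroup G -> is_cyclic G -> (G #= `I_n)%card ->
       PGL3_definable_over_R G ->
       forall A : GL 3 R[i],
         generates (GLproj A) G -> has_real_coefs (char_poly A)).
Proof.
split.
  move=> n G _ Gs _ Gn [A [AG [q qA]]].
  have Gf : finite_set G by apply/finite_setP; exists n.
  have [k k0] := finite_subgroup_torsion Gs Gf (generates_mem AG).
  rewrite -gmulfXn => /GLprojP[c c0]; rewrite GLmxX /= scalemx1 => Ak.
  have [P [d [Pu PA]]] := diagonalizable_root_scalar k0 c0 Ak.
  have [Q [B [Qu QA]]] := real_form_diagonalizable Pu PA qA.
  have Bu : B \in unitmx.
    rewrite -(map_unitmx (real_complex R)).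
    by rewrite -[map_mx _ _](mulmxK Qu) -QA !unitmx_mul Qu GLmx_unit unitmx_inv.
  pose g : GL 3 R[i] := MkGL Qu.
  apply: (@definable_of_generator _ _ _ (GLproj g)^-1%g (GLproj (MkGL Bu)) AG).
  rewrite PGLmap_proj -gmulfV -gmulfJ; congr GLproj; apply: val_inj => /=.
  by rewrite invmxK mulmxA QA mulmxK.
have [B [B3 B1]] := PGL3_order3 R.
pose x := PGLmap (real_complex R) (GLproj B).
have x3 : (x ^+ 3 = 1)%g by rewrite -gmulfXn B3 gmulf1.
have xk k : (0 < k < 3)%N -> (x ^+ k <> 1)%g.
  suff x1 : (x <> 1)%g.
    case: k => [|[|[|]]] // _ x2; apply: x1.
    by rewrite -x3 expgS x2 mulg1.
  by rewrite -(PGLmap1 3 (real_complex R)) => /PGLmap_inj.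
have xG := generates_powers (isT : 0 < 3)%N x3.
(* The factor i has a nonreal cube, and the determinant of a matrix of size 3
   is homogeneous of degree 3. *)
have iBu : 'i%C *: GLmx (GLmap (real_complex R) B) \in unitmx.
  by rewrite unitmxZ ?GLmx_unit // unitfE eq_complex /= oner_eq0 andbF.
have AE : GLproj (MkGL iBu) = x.
  rewrite /x PGLmap_proj; apply/GLprojP; exists 'i%C => //.
  by rewrite eq_complex /= oner_eq0 andbF.
move=> /(_ 3 _ isT (generates_subgroup xG) (ex_intro _ x xG) (card_powers xk)).
case/(_ _ (MkGL iBu)).
- apply: (@definable_of_generator _ _ _ 1%g (GLproj B) xG).
  by rewrite conjg1.
- by rewrite AE.
move=> q /(congr1 (fun p : {poly _} => p`_0)).
rewrite char_poly_det coef_map /= detZ det_map_mx.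
have : \det (GLmx B) != 0 by rewrite -unitfE -unitmxE GLmx_unit.
move: (\det _) (q`_0) => b q0 b0.
rewrite !exprS expr0 mulr1; simpc.
move=> -[_ /eqP].
by rewrite (negPf b0).
Qed.
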